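(* Let $p$ be a prime and let $G, H$ be countably based abelian pro-$p$ groups with unbounded torsion. Then $G$ and $H$ are isomorphic as abstract groups if and only if $t(G)$ is isomorphic to $t(H)$ (as abstract groups).
   Context: A profinite group is countably based if its identity has a countable neighbourhood basis. $t(G)$ denotes the subgroup of torsion elements of an abelian group $G$. A group has unbounded torsion if its torsion elements have unbounded exponent, i.e. there is no $n\geq 1$ annihilating all torsion elements. ''Isomorphic as abstract groups'' means isomorphic as groups, ignoring topology. *)

(* Defs.v *)
From HB Require Import structures.
From mathcomp Require Import all_boot all_order all_algebra ring_quotient.
From mathcomp Require Import boolp classical_sets functions cardinality.
From mathcomp Require Import topology tvs.

Set Implicit Arguments.
Unset Strict Implicit.
Unset Printing Implicit Defensive.

Import GRing.Theory.
Local Open Scope classical_set_scope.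
Local Open Scope card_scope.
Local Open Scope ring_scope.

(* Isomorphism of abelian groups; any topology on A or B is ignored. *)
Definition group_isom (A B : zmodType) : Prop :=
  exists f : {additive A -> B}, bijective f.

Section Torsion.
Variable G : zmodType.

Definition torsion : {pred G} :=
  [pred x : G | `[< exists n : nat, (0 < n)%N /\ x *+ n = 0 >] ].

Lemma torsionP (x : G) :
  reflect (exists n : nat, (0 < n)%N /\ x *+ n = 0) (x \in torsion).
Proof. exact: asboolP. Qed.

Lemma torsion_zmod_closed : zmod_closed torsion.
Proof.
split=> [|x y /torsionP[m [m0 xm]] /torsionP[n [n0 yn]]]; apply/torsionP.
  by exists 1%N; rewrite mul0rn.
exists (m * n)%N; rewrite muln_gt0 m0 n0; split=> //.
by rewrite mulrnBl mulrnA xm mul0rn sub0r mulnC mulrnA yn mul0rn oppr0.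
Qed.

HB.instance Definition _ := GRing.isZmodClosed.Build G torsion torsion_zmod_closed.

(* t(G), as an abelian group in its own right. *)
Record torsion_subgroup := TorsionSubgroup {
  torsion_val :> G;
  torsion_valP : torsion_val \in torsion
}.

HB.instance Definition _ := [isSub for torsion_val].
HB.instance Definition _ := [Choice of torsion_subgroup by <:].
HB.instance Definition _ := [SubChoice_isSubZmodule of torsion_subgroup by <:].

Definition unbounded_torsion : Prop :=
  ~ exists n : nat, (0 < n)%N /\ forall x : G, x \in torsion -> x *+ n = 0.

End Torsion.

Section Profinite.
Variable G : topologicalZmodType.

Definition profinite : Prop :=
  [/\ compact [set: G], hausdorff_space G & totally_disconnected [set: G]].

(* The index of U in G is the cardinality of G / U. As G is abelian, every
   subgroup is normal. *)
Definition pro_p (p : nat) : Prop :=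
  profinite /\
  forall U : zmodClosed G, open [set x : G | x \in U] ->
    exists k : nat, [set: {ideal_quot U}] #= `I_(p ^ k)%N.

Definition countably_based : Prop :=
  exists B : set (set G),
    [/\ countable B, B `<=` nbhs (0 : G) & filter_from B id --> (0 : G)].

End Profinite.

(* Main.v *)
(* As an abstract group, G is p-adically complete and separated, so it is determined by any
   dense pure subgroup. Put S = t(G) + pG. If a family in G becomes a basis of the
   F_p-vector space G / S, then t(G) together with this family generates a dense pure
   subgroup, in which the family is free over t(G). Hence G is determined by t(G) and the
   dimension of G / S, and it remains to see that this dimension is the continuum.

   It is at most the continuum because G is countably based. For the lower bound, S is the
   increasing union of the closed subgroups W_n = G[n!] + pG, and unbounded torsion forces
   every open subgroup to meet S outside each W_n. One can therefore choose v_j in S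
   inside open subgroups shrinking so fast that an infinite sum of multiples c_j v_j, with c_j
   prime to p infinitely often, is never in S. Summing the v_j along the branches of the binary tree gives a
   continuum of elements independent modulo S. *)
Require Import Defs.
From HB Require Import structures.
From mathcomp Require Import all_boot all_order all_algebra ring_quotient.
From mathcomp Require Import boolp classical_sets functions cardinality.
From mathcomp Require Import topology tvs.

Set Implicit Arguments.
Unset Strict Implicit.
Unset Printing Implicit Defensive.

Import GRing.Theory.
Local Open Scope ring_scope.

(** * Extension of isomorphisms to p-adic completions *)

Definition multiple (G : zmodType) (m : nat) (x : G) := exists y : G, x = y *+ m.

Section Multiples.
Variables (G : zmodType) (m : nat).
Implicit Types x y : G.

Lemma multiple0 : multiple m (0 : G).
Proof. by exists 0; rewrite mul0rn. Qed.

Lemma multipleD x y : multiple m x -> multiple m y -> multiple m (x + y).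
Proof. by move=> [a ->] [b ->]; exists (a + b); rewrite mulrnDl. Qed.

Lemma multipleB x y : multiple m x -> multiple m y -> multiple m (x - y).
Proof. by move=> [a ->] [b ->]; exists (a - b); rewrite mulrnBl. Qed.

End Multiples.

(** Separatedness and completeness for the p-adic filtration, stated algebraically. Cauchy sequences
    are normalised so that the step from [u n] to [u n.+1] already has precision [p ^ n]. *)
Definition p_complete (p : nat) (G : zmodType) : Prop :=
  (forall x : G, (forall n, multiple (p ^ n) x) -> x = 0) /\
  (forall u : nat -> G, (forall n, multiple (p ^ n) (u n.+1 - u n)) ->
     exists l, forall n, multiple (p ^ n) (l - u n)).

(* [Gam] is the graph of an isomorphism between dense pure subgroups of G and H. Purity
   makes it uniformly continuous for the p-adic topologies, so [rel_closure] is the graph of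
   its extension to G. *)
Section Extension.
Variables (p : nat) (G H : zmodType) (Gam : G -> H -> Prop).

Definition additive_rel :=
  Gam 0 0 /\ forall a b a' b', Gam a b -> Gam a' b' -> Gam (a - a') (b - b').

Definition rel_dense := forall g, exists a b, Gam a b /\ multiple p (g - a).

(** Every root [g] of [a] in G has to lie in the domain, not just some root. A pure subgroup has
    this property as soon as it contains t(G). *)
Definition rel_pure := forall a b g, Gam a b -> a = g *+ p ->
  exists h, Gam g h /\ b = h *+ p.

Definition rel_closure g h := forall n, exists a b,
  [/\ Gam a b, multiple (p ^ n) (g - a) & multiple (p ^ n) (h - b)].

Hypotheses (Gadd : additive_rel) (Gdense : rel_dense) (Gpure : rel_pure).

Lemma relB a b a' b' : Gam a b -> Gam a' b' -> Gam (a - a') (b - b').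
Proof. by case: Gadd => _; apply. Qed.

Lemma relD a b a' b' : Gam a b -> Gam a' b' -> Gam (a + a') (b + b').
Proof.
move=> ab ab'; rewrite -[a']opprK -[b']opprK; apply: relB => //.
by rewrite -[- a']add0r -[- b']add0r; apply: relB => //; case: Gadd.
Qed.

Lemma relMn a b n : Gam a b -> Gam (a *+ n) (b *+ n).
Proof.
move=> ab; elim: n => [|n IH]; first by rewrite !mulr0n; case: Gadd.
by rewrite !mulrS; apply: relD.
Qed.

(** Density modulo p is iterated: after [g - a] is divided by p, the quotient is approximated in
    turn. *)
Lemma rel_dense_exp n g : exists a b, Gam a b /\ multiple (p ^ n) (g - a).
Proof.
elim: n g => [|n IH] g.
  by exists 0, 0; split; [case: Gadd | exists g; rewrite subr0 expn0 mulr1n].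
have [a [b [ab [g' e]]]] := Gdense g.
have [a' [b' [ab' [g'' e']]]] := IH g'.
exists (a + a' *+ p), (b + b' *+ p); split; first by apply: relD => //; apply: relMn.
exists g''; rewrite opprD addrA e -mulrnBl e' -mulrnA.
by rewrite expnS mulnC.
Qed.

Lemma rel_pure_exp n a b : Gam a b -> multiple (p ^ n) a -> multiple (p ^ n) b.
Proof.
move=> + [g e]; elim: n a b e => [|n IH] a b e ab.
  by exists b; rewrite expn0 mulr1n.
have [|h [gh ->]] := Gpure (g := g *+ p ^ n) ab; first by rewrite -mulrnA mulnC -expnS.
by have [h' ->] := IH _ _ (erefl _) gh; exists h'; rewrite -mulrnA mulnC -expnS.
Qed.

Hypothesis Hcomp : p_complete p H.

(** Take partners of p-adic approximations of [g]. By [rel_pure_exp] they form a Cauchy sequence in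
    H, and its limit is the required [h]. *)
Lemma rel_closure_total g : exists h, rel_closure g h.
Proof.
have /choice[u Hu] : forall n, exists ab : G * H,
    Gam ab.1 ab.2 /\ multiple (p ^ n) (g - ab.1).
  by move=> n; have [a [b ?]] := rel_dense_exp n g; exists (a, b).
case: Hcomp => _ /(_ (fun n => (u n).2)) [n|l Hl].
  have [r1 d1] := Hu n; have [r2 d2] := Hu n.+1.
  apply: rel_pure_exp (relB r2 r1) _.
  have -> : (u n.+1).1 - (u n).1 = (g - (u n).1) - (g - (u n.+1).1).
    by rewrite opprB [RHS]addrC addrA subrK.
  apply: multipleB => //; case: d2 => y ->; exists (y *+ p).
  by rewrite -mulrnA -expnS.
exists l => n; have [r d] := Hu n.
by exists (u n).1, (u n).2.
Qed.

Lemma rel_closureB g h g' h' :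
  rel_closure g h -> rel_closure g' h' -> rel_closure (g - g') (h - h').
Proof.
move=> c c' n; have [a [b [ab ga hb]]] := c n; have [a' [b' [ab' ga' hb']]] := c' n.
exists (a - a'), (b - b'); split; first exact: relB.
- by rewrite opprD addrACA -opprD; apply: multipleB.
- by rewrite opprD addrACA -opprD; apply: multipleB.
Qed.

Lemma rel_closure0 h : rel_closure 0 h -> h = 0.
Proof.
move=> c; case: Hcomp => sep _; apply: sep => n.
have [a [b [ab ga hb]]] := c n; rewrite -[h](subrK b); apply: multipleD => //.
apply: rel_pure_exp ab _; rewrite -[a]opprK -sub0r -[- a]add0r.
by apply: multipleB => //; apply: multiple0.
Qed.

Lemma rel_closure_fun g h h' : rel_closure g h -> rel_closure g h' -> h = h'.
Proof.
move=> c c'; apply/eqP; rewrite -subr_eq0; apply/eqP/rel_closure0.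
by rewrite -(subrr g); apply: rel_closureB.
Qed.

End Extension.

Lemma rel_closureC p (G H : zmodType) (Gam : G -> H -> Prop) g h :
  rel_closure p Gam g h -> rel_closure p (fun b a => Gam a b) h g.
Proof. by move=> c n; have [a [b []]] := c n; exists b, a. Qed.

Lemma additive_relC (G H : zmodType) (Gam : G -> H -> Prop) :
  additive_rel Gam -> additive_rel (fun b a => Gam a b).
Proof. by case=> G0 GB; split=> // a b a' b'; apply: GB. Qed.

(** The closure is total and single-valued in both directions and symmetric in the two groups, so
    the two functions it defines are mutually inverse. *)
Lemma rel_extension_isom p (G H : zmodType) (Gam : G -> H -> Prop) :
  additive_rel Gam -> rel_dense p Gam -> rel_pure p Gam ->
  rel_dense p (fun h g => Gam g h) -> rel_pure p (fun h g => Gam g h) ->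
  p_complete p G -> p_complete p H -> group_isom G H.
Proof.
move=> add den pur den' pur' cG cH.
have add' := additive_relC add.
have /choice[f Hf] := rel_closure_total add den pur cH.
have /choice[f' Hf'] := rel_closure_total add' den' pur' cG.
have fB : zmod_morphism f.
  move=> x y; apply: (rel_closure_fun add pur cH) (Hf _) _.
  exact: rel_closureB.
pose F : {additive G -> H} := HB.pack f (GRing.isZmodMorphism.Build G H f fB).
exists F; exists f' => [g|h] /=.
- apply: (rel_closure_fun add' pur' cG) (Hf' _) _.
  exact: rel_closureC.
- apply: (rel_closure_fun add pur cH) (Hf _) _.
  exact: rel_closureC (Hf' h).
Qed.

(** * Bases modulo t(G) + pG *)

Section TorsionMod.
Variables (p : nat) (G : zmodType).

Definition torsion_mod : {pred G} :=
  [pred x : G | `[< exists t g : G, t \in torsion (G := G) /\ x = t + g *+ p >] ].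

Lemma torsion_modP (x : G) :
  reflect (exists t g : G, t \in torsion (G := G) /\ x = t + g *+ p) (x \in torsion_mod).
Proof. exact: asboolP. Qed.

Lemma torsion_mod_zmod_closed : zmod_closed torsion_mod.
Proof.
split=> [|_ _ /torsion_modP[t [g [tT ->]]] /torsion_modP[t' [g' [tT' ->]]]].
  by apply/torsion_modP; exists 0, 0; rewrite rpred0 mul0rn addr0.
apply/torsion_modP; exists (t - t'), (g - g'); split; first exact: rpredB.
by rewrite opprD addrACA mulrnBl.
Qed.

HB.instance Definition _ :=
  GRing.isZmodClosed.Build G torsion_mod torsion_mod_zmod_closed.

Lemma torsion_mod_multiple (x : G) : x *+ p \in torsion_mod.
Proof. by apply/torsion_modP; exists 0, x; rewrite rpred0 add0r. Qed.

Lemma torsion_mod_dvdz (x : G) (c : int) : (p %| c)%Z -> x *~ c \in torsion_mod.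
Proof. by case/dvdzP=> d ->; rewrite mulrzA -pmulrn torsion_mod_multiple. Qed.

Lemma torsion_torsion_mod (x : G) : x \in torsion (G := G) -> x \in torsion_mod.
Proof. by move=> xT; apply/torsion_modP; exists x, 0; rewrite mul0rn addr0. Qed.

Lemma torsion_mulrn (x : G) : (0 < p)%N -> x *+ p \in torsion (G := G) ->
  x \in torsion (G := G).
Proof.
move=> p0 /torsionP[n [n0 e]]; apply/torsionP; exists (p * n)%N.
by rewrite muln_gt0 p0 n0 mulrnA.
Qed.

Section Families.
Variables (I : choiceType) (x : I -> G).

Definition lin (s : seq I) (c : I -> int) : G := \sum_(i <- s) x i *~ c i.

(** Linear independence over F_p of the images in G / S, where S = t(G) + pG; integers serve as
    lifts of the scalars. *)
Definition independent := forall s c, uniq s -> lin s c \in torsion_mod ->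
  forall i, i \in s -> (p %| c i)%Z.

Definition spanning := forall g : G, exists s c, uniq s /\ g - lin s c \in torsion_mod.

Lemma lin_widen (s s' : seq I) c : uniq s -> uniq s' -> {subset s <= s'} ->
  lin s c = lin s' (fun i => if i \in s then c i else 0).
Proof.
move=> us us' sub; rewrite /lin [RHS](bigID (mem s)) /= [X in _ + X]big1 ?addr0; last first.
  by move=> i /negPf ->.
under [RHS]eq_bigr => i is_ do rewrite is_.
rewrite -[RHS]big_filter.
apply/perm_big/uniq_perm => //; first exact: filter_uniq.
by move=> i; rewrite mem_filter; case: (boolP (i \in s)) => //= /sub ->.
Qed.

Lemma linB s c c' : lin s c - lin s c' = lin s (fun i => c i - c' i).
Proof. by rewrite /lin -sumrB; apply: eq_bigr => i _; rewrite mulrzBr. Qed.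

Lemma lin_mulrz s c z : lin s c *~ z = lin s (fun i => c i * z).
Proof. by rewrite /lin mulrz_suml; apply: eq_bigr => i _; rewrite mulrzA. Qed.

Lemma lin_divz s c : (forall i, i \in s -> (p %| c i)%Z) ->
  lin s c = lin s (fun i => (c i %/ p)%Z) *+ p.
Proof.
move=> pc; rewrite pmulrn lin_mulrz; apply: eq_big_seq => i /pc; rewrite dvdz_eq.
by move=> /eqP ->.
Qed.

End Families.
End TorsionMod.

Arguments torsion_mod p {G}.

(** * The partial isomorphism given by two bases and an isomorphism of torsion subgroups *)

Section BasisRelation.
Variables (p : nat) (G H : zmodType) (I : choiceType) (x : I -> G) (y : I -> H).
Variable phi : {additive torsion_subgroup G -> torsion_subgroup H}.

(** The graph of the map on t(G) + span(x) that extends [phi] and sends [x i] to [y i]. It is kept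
    as a relation; single-valuedness comes from [rel_closure_fun]. *)
Definition basis_rel (a : G) (b : H) := exists s c (t : torsion_subgroup G),
  [/\ uniq s, a = torsion_val t + lin x s c & b = torsion_val (phi t) + lin y s c].

Lemma basis_rel_additive : additive_rel basis_rel.
Proof.
split.
  exists [::], (fun=> 0), 0; rewrite /lin !big_nil !addr0 raddf0.
  by split.
move=> _ _ _ _ [s [c [t [us -> ->]]]] [s' [c' [t' [us' -> ->]]]].
pose r := undup (s ++ s').
have ur : uniq r by apply: undup_uniq.
have sr : {subset s <= r} by move=> i is_; rewrite mem_undup mem_cat is_.
have sr' : {subset s' <= r} by move=> i is_; rewrite mem_undup mem_cat is_ orbT.
rewrite !(lin_widen _ _ us ur sr) !(lin_widen _ _ us' ur sr').
exists r, (fun i => (if i \in s then c i else 0) - (if i \in s' then c' i else 0)), (t - t').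
split=> //; first by rewrite opprD addrACA linB.
by rewrite opprD addrACA linB raddfB.
Qed.

Lemma basis_rel_dense : spanning p x -> rel_dense p basis_rel.
Proof.
move=> sx g; have [s [c [us /torsion_modP[t [g' [tT e]]]]]] := sx g.
pose t' := TorsionSubgroup tT.
exists (t + lin x s c), (torsion_val (phi t') + lin y s c); split.
  by exists s, c, t'.
by exists g'; rewrite [t + _]addrC opprD addrA e addrC addKr.
Qed.

(** If t + sum c_i x_i = pg, independence makes every c_i divisible by p. Then g - sum (c_i / p) x_i
    is torsion, since p times it is t, and [phi] carries it to H. *)
Lemma basis_rel_pure : (0 < p)%N -> independent p x -> rel_pure p basis_rel.
Proof.
move=> p0 ix _ _ g [s [c [t [us -> ->]]]] e.
have pc : forall i, i \in s -> (p %| c i)%Z.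
  apply: ix => //; apply/torsion_modP; exists (- torsion_val t), g.
  by rewrite rpredN (torsion_valP t) -e addrA addNr add0r.
pose d i := (c i %/ p)%Z.
have tp : torsion_val t = (g - lin x s d) *+ p.
  by rewrite mulrnBl -e -(lin_divz _ pc) addrK.
have gT : g - lin x s d \in torsion (G := G).
  by apply: (torsion_mulrn p0); rewrite -tp torsion_valP.
pose t' := TorsionSubgroup gT.
have -> : t = t' *+ p by apply: val_inj; rewrite [LHS]tp raddfMn.
exists (torsion_val (phi t') + lin y s d); split.
  by exists s, d, t'; rewrite subrK.
by rewrite (lin_divz y pc) mulrnDl raddfMn -[torsion_val (_ *+ _)]/(val _) [val _]raddfMn.
Qed.

End BasisRelation.

Lemma basis_isom (p : nat) (G H : zmodType) (I : choiceType) (x : I -> G) (y : I -> H) :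
  (0 < p)%N -> p_complete p G -> p_complete p H ->
  independent p x -> spanning p x -> independent p y -> spanning p y ->
  group_isom (torsion_subgroup G) (torsion_subgroup H) -> group_isom G H.
Proof.
move=> p0 cG cH ix sx iy sy [phi [phi' phiK phi'K]].
have phi'B : zmod_morphism phi'.
  by move=> u v; apply: (can_inj phiK); rewrite raddfB !phi'K.
pose psi : {additive torsion_subgroup H -> torsion_subgroup G} :=
  HB.pack phi' (GRing.isZmodMorphism.Build _ _ phi' phi'B).
(* The converse relation is the same construction for the inverse of [phi], so density and purity on
   the side of H need no new proof. *)
have eC : (fun b a => basis_rel x y phi a b) = basis_rel y x psi.
  apply/funext => b; apply/funext => a; apply/propext; split.
    by move=> [s [c [t [us ea eb]]]]; exists s, c, (phi t); split; rewrite /= ?phiK.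
  by move=> [s [c [t [us ea eb]]]]; exists s, c, (psi t); split; rewrite /= ?phi'K.
apply: (rel_extension_isom (p := p) (Gam := basis_rel x y phi)) => //.
- exact: basis_rel_additive.
- exact: basis_rel_dense.
- exact: basis_rel_pure.
- by rewrite eC; apply: basis_rel_dense.
- by rewrite eC; apply: basis_rel_pure.
Qed.

(** * Existence of bases with a prescribed index set *)

Lemma prime_invz (p : nat) (c : int) : prime p -> ~~ (p %| c)%Z ->
  exists d k : int, d * c = 1 + k * p.
Proof.
move=> pp npc; have [u [v e]] := Bezoutz c p.
have g1 : gcdz c p = 1.
  apply/eqP; rewrite -[_ == _]/(coprimez c p) coprimez_sym coprimezE prime_coprime //.
exists u, (- v); rewrite mulNr -[X in X - _]g1 -e addrK //.
Qed.

Section Basis.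
Local Open Scope classical_set_scope.
Variables (p : nat) (G : zmodType) (p_prime : prime p).

(** Sets replace families here because Zorn's lemma is applied to subsets of G. *)
Definition independent_set (X : set G) := forall s c, uniq s ->
  (forall g, g \in s -> X g) -> lin id s c \in torsion_mod p ->
  forall g, g \in s -> (p %| c g)%Z.

Definition spanning_set (X : set G) := forall g, exists s c,
  [/\ uniq s, (forall h, h \in s -> X h) & g - lin id s c \in torsion_mod p].

Section Families.
Variables (I : choiceType) (x : I -> G).

Lemma independent_inj : independent p x -> injective x.
Proof.
move=> ix i j e; apply/eqP/negPn/negP => ij.
have ls : lin x [:: i; j] (fun k => if k == i then 1 else -1) \in torsion_mod p.
  rewrite /lin big_cons big_seq1 eqxx eq_sym (negPf ij) e mulrN1z mulr1z subrr.
  exact: rpred0.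
have := ix _ _ _ ls i; rewrite /= !inE ij eqxx dvdz1 => /(_ isT isT).
by rewrite -[_ == _]/(p == 1)%N (gtn_eqF (prime_gt1 p_prime)).
Qed.

Lemma lin_map s c : lin id (map x s) c = lin x s (c \o x).
Proof. by rewrite /lin big_map. Qed.

Lemma section_of_injective (i0 : I) : injective x -> exists f, cancel x f.
Proof.
move=> xi; have /choice[f Hf] : forall g, exists i, (exists j, x j = g) -> x i = g.
  move=> g; have [[j e]|n] := pselect (exists j, x j = g); first by exists j.
  (* Outside the range the value is the arbitrary default [i0]. *)
  by exists i0 => /n.
by exists f => i; apply: xi; apply: Hf; exists i.
Qed.

Lemma independent_range (i0 : I) : independent p x -> independent_set (range x).
Proof.
move=> ix s c us sx; have xi := independent_inj ix.
have [f fK] := section_of_injective i0 xi.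
have es : s = map x (map f s).
  rewrite -map_comp -[LHS]map_id; apply/eq_in_map => g /sx[i _ <-] /=.
  by rewrite fK.
rewrite es lin_map => ls _ /mapP[i i_s ->].
apply: (ix _ _ _ ls) => //.
by rewrite -(map_inj_uniq xi) -es.
Qed.

Lemma range_independent (i0 : I) : injective x -> independent_set (range x) ->
  independent p x.
Proof.
move=> xi ix s c us ls i i_s; have [f fK] := section_of_injective i0 xi.
have := ix (map x s) (c \o f); rewrite map_inj_uniq // lin_map.
have -> : lin x s ((c \o f) \o x) = lin x s c by apply: eq_bigr => j _ /=; rewrite fK.
move=> H; have := H us _ ls (x i); rewrite /= fK; apply; last exact: map_f.
by move=> _ /mapP[j _ ->]; exists j.
Qed.

Lemma range_spanning (i0 : I) : injective x -> spanning_set (range x) -> spanning p x.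
Proof.
move=> xi sx g; have [s [c [us sr e]]] := sx g.
have [f fK] := section_of_injective i0 xi.
have es : s = map x (map f s).
  rewrite -map_comp -[LHS]map_id; apply/eq_in_map => h /sr[i _ <-] /=.
  by rewrite fK.
exists (map f s), (c \o x); rewrite -lin_map // -es; split=> //.
by rewrite -(map_inj_uniq xi) -es.
Qed.

End Families.

(** A relation involves finitely many elements, so it already lives over a single member of the
    chain. Keeping [X0] outside the union covers the empty chain. *)
Lemma independent_set_chain (X0 : set G) (F : set (set G)) : independent_set X0 ->
  F `<=` [set X | independent_set (X0 `|` X)] -> total_on F subset ->
  independent_set (X0 `|` \bigcup_(X in F) X).
Proof.
move=> iX0 FP tot s c us sX.
suff [X [iX sub]] : exists X, independent_set (X0 `|` X) /\ (forall g, g \in s -> (X0 `|` X) g).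
  exact: iX.
suff [X [FX sub]] : exists X, (X = set0 \/ F X) /\ (forall g, g \in s -> (X0 `|` X) g).
  by exists X; split=> //; case: FX => [->|/FP//]; rewrite setU0.
elim: s sX {us} => [|g s IH] sX; first by exists set0; split=> //; left.
have [|X [FX sub]] := IH; first by move=> h hs; apply: sX; rewrite inE hs orbT.
have [g0|[Y FY Yg]] := sX g (mem_head _ _).
  by exists X; split=> // h; rewrite inE => /orP[/eqP ->|/sub//]; left.
case: FX => [X0e|FX].
  exists Y; split; first by right.
  by move=> h; rewrite inE => /orP[/eqP ->|/sub]; [right|rewrite X0e setU0; left].
have [XY|YX] := tot _ _ FX FY.
  exists Y; split; first by right.
  by move=> h; rewrite inE => /orP[/eqP ->|/sub[]]; [right|left|move/XY; right].
exists X; split; first by right.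
by move=> h; rewrite inE => /orP[/eqP ->|/sub//]; right; apply: YX.
Qed.

(** A nontrivial relation over X and g has a coefficient at g prime to p, by independence of X;
    inverting it modulo p expresses g through X. *)
Lemma maximal_spanning (X : set G) : independent_set X ->
  (forall g, ~ X g -> ~ independent_set (g |` X)) -> spanning_set X.
Proof.
move=> iX mX g; have [Xg|nXg] := pselect (X g).
  exists [:: g], (fun=> 1); split=> //; first by move=> h; rewrite inE => /eqP ->.
  by rewrite /lin big_seq1 mulr1z subrr rpred0.
have /existsNP[s /existsNP[c]] := mX _ nXg.
move=> /not_implyP[us /not_implyP[sX /not_implyP[ls /existsNP[h /not_implyP[hs nh]]]]].
have gs : g \in s.
  apply: contrapT => /negP gs; apply: nh; apply: iX ls _ hs => // k ks.
  by case: (sX k ks) => // e; rewrite -e ks in gs.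
have sX' k : k \in rem g s -> X k.
  rewrite mem_rem_uniq // inE => /andP[/eqP kg ks].
  by case: (sX k ks).
have els : lin id s c = g *~ c g + lin id (rem g s) c by rewrite /lin (big_rem g).
have npc : ~~ (p %| c g)%Z.
  apply/negP => pc; apply: nh; have [->//|hg] := eqVneq h g.
  apply: (iX (rem g s)) => //; first exact: rem_uniq.
    rewrite -[lin _ _ _](addKr (g *~ c g)) -els rpredD // rpredN.
    exact: torsion_mod_dvdz.
  by rewrite mem_rem_uniq // inE hg.
have [d [k e]] := prime_invz p_prime npc.
exists (rem g s), (fun i => c i * - d); split=> //; first exact: rem_uniq.
rewrite -lin_mulrz mulrNz opprK.
have -> : lin id (rem g s) c = lin id s c - g *~ c g by rewrite els addrC addKr.
rewrite mulrzBl -mulrzA [c g * d]mulrC e mulrzDr mulr1z opprD addrCA addNKr.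
by apply: rpredB; [rewrite rpredMz|rewrite torsion_mod_dvdz // dvdz_mull].
Qed.

Lemma exists_basis (I : choiceType) (i0 : I) (e : I -> G) (f : G -> I) :
  injective f -> independent p e ->
  exists x : I -> G, independent p x /\ spanning p x.
Proof.
move=> fi ie; have ei := independent_inj ie.
have [A [PA mA]] := Zorn_bigcup (fun F => @independent_set_chain _ F (independent_range i0 ie)).
pose X := range e `|` A; have {PA} iX : independent_set X := PA.
have sX : spanning_set X.
  apply: maximal_spanning => // g nXg iXg; apply: (mA (g |` A)).
    split; first by move=> h; right.
    by move=> /(_ g) sub; apply: nXg; right; apply: sub; left.
  by rewrite /= setUCA.
(* [e] injects [I] into X and [f] injects X into [I], so X can be reindexed by [I]. *)
have /card_set_bijP[x [xX xi xs]] : ([set: I] #= X)%card.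
  have embed U V (u : U -> V) : injective u -> ([set: U] #<= range u)%card.
    move=> ui; have : (range u #= [set: U])%card by apply: inj_card_eq => a b _ _ /ui.
    by rewrite card_eq_le => /andP[].
  apply: Cantor_Bernstein.
    by apply: card_le_trans (embed _ _ _ ei) (subset_card_le _); left.
  exact: card_le_trans (card_leT _) (card_le_trans (embed _ _ _ fi) (card_leT _)).
have {}xi : injective x by move=> i j; apply: xi; rewrite inE.
have rx : range x = X.
  apply/seteqP; split=> [_ [i _ <-]|]; [exact: xX|exact: xs].
exists x; rewrite -rx in iX sX.
by split; [exact: range_independent|exact: range_spanning].
Qed.

End Basis.

(** * Compact topological abelian groups *)

Section Compactness.
Local Open Scope classical_set_scope.

(** Otherwise the sets C j minus W generate a proper filter, and its cluster point lies in every C j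
    but not in W. *)
Lemma compact_directed (T : topologicalType) (J : Type) (D : set J) (C : J -> set T)
    (W : set T) :
  compact [set: T] -> D !=set0 -> (forall j, D j -> closed (C j)) ->
  (forall i j, D i -> D j -> exists2 k, D k & C k `<=` C i `&` C j) ->
  open W -> \bigcap_(j in D) C j `<=` W -> exists2 j, D j & C j `<=` W.
Proof.
move=> cT D0 clC dirC oW capW; apply: contrapT => noj.
pose F := filter_from D (fun j => C j `\` W).
have FF : Filter F.
  apply: filter_from_filter => // i j Di Dj; have [k Dk sub] := dirC i j Di Dj.
  by exists k => // x [/sub[]].
have PF : ProperFilter F.
  apply: filter_from_proper => j Dj; apply: contrapT => e; apply: noj; exists j => // x Cx.
  by apply: contrapT => nW; apply: e; exists x.
have [x [_ cl]] := cT F PF filterT.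
have clx A : F A -> closed A -> A x by move=> FA; apply=> B Bx; apply: cl.
have [j Dj] := D0.
have : (~` W) x by apply: clx; [exists j => // y []|apply: open_closedC].
apply; apply: capW => i Di; apply: clx; last exact: clC.
by exists i => // y [].
Qed.

Lemma totally_disconnected_zero_dimensional (T : topologicalType) :
  compact [set: T] -> hausdorff_space T -> totally_disconnected [set: T] ->
  zero_dimensional T.
Proof.
move=> cT hT tdT x y xy; apply: contrapT => nosep.
(* The quasi-component Q of x is connected. *)
pose D : set (set T) := [set A | clopen A /\ A x].
pose Q := \bigcap_(A in D) A.
have D0 : D !=set0 by exists setT; split=> //; apply: clopenT.
have clQ : closed Q by apply: closed_bigI => A [[]].
have inQ W : open W -> Q `<=` W -> exists2 A, D A & A `<=` W.
  apply: compact_directed => // [A [[]]//|A B [cA Ax] [cB Bx]].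
  by exists (A `&` B) => //; split=> //; apply: clopenI.
have Qx : Q x by move=> A [].
have Qy : Q y.
  by move=> A [cA Ax]; apply: contrapT => nAy; apply: nosep; exists A.
have cQ : connected Q.
  move=> B B0 [C1 oC1 eB1] [C2 cC2 eB2].
  have clB : closed B by rewrite eB2; apply: closedI.
  have BQ : B `<=` Q by rewrite eB2 => z [].
  have clE : closed (Q `\` B).
    suff -> : Q `\` B = Q `&` ~` C1 by apply: closedI => //; apply: open_closedC.
    rewrite eB1; apply/seteqP; split=> z [Qz nz]; split=> //; last by case.
    by move=> ?; apply: nz.
  (* Normality separates the closed pieces B and Q minus B by disjoint open sets U and V. *)
  have /(compact_normal hT cT clB)[N /set_nbhsP[U [oU BU UN]] clN] : set_nbhs B (~` (Q `\` B)).
    apply/set_nbhsP; exists (~` (Q `\` B)); split=> //; first exact: closed_openC.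
    by move=> z Bz [].
  pose V := ~` closure N.
  have oV : open V by apply/closed_openC/closed_closure.
  have UV z : U z -> V z -> False by move=> /UN/subset_closure.
  have EV : Q `\` B `<=` V by move=> z Ez /clN.
  (* A clopen A inside the union of U and V is cut by them into two clopen pieces. The piece
     containing x contains all of Q, so Q meets only one of U and V. *)
  have [||A [[oA cA] Ax] AUV] := inQ (U `|` V); first exact: openU.
    by move=> z Qz; have [/BU|nB] := pselect (B z); [left|right; apply: EV].
  have clopenAU : clopen (A `&` U).
    split; first exact: openI.
    suff -> : A `&` U = A `&` ~` V by apply: closedI => //; apply: open_closedC.
    apply/seteqP; split=> z [Az nz]; split=> //; first by move/(UV _ nz).
    by case: (AUV z Az).
  have clopenAV : clopen (A `&` V).
    split; first exact: openI.
    suff -> : A `&` V = A `&` ~` U by apply: closedI => //; apply: open_closedC.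
    apply/seteqP; split=> z [Az nz]; split=> //; first by move=> /UV; apply.
    by case: (AUV z Az).
  have [Ux|Vx] := AUV x Ax.
    apply/seteqP; split=> // z Qz; apply: contrapT => nB.
    have [_ Uz] : (A `&` U) z by apply: Qz.
    by apply: (UV z Uz); apply: EV.
  have [b Bb] := B0; have [_ Vb] : (A `&` V) b by apply: BQ.
  by case: (UV b (BU _ Bb) Vb).
have : connected_component setT x y by exists Q.
by rewrite tdT //= => e; rewrite e eqxx in xy.
Qed.

End Compactness.

(** * Open subgroups, closed subgroups and limits *)

Section TopologicalGroup.
Local Open Scope classical_set_scope.
Variable G : topologicalZmodType.

Definition carrier (U : zmodClosed G) : set G := [set x | x \in U].

Lemma continuous_add (T : topologicalType) (f g : T -> G) :
  continuous f -> continuous g -> continuous (fun x => f x + g x).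
Proof.
move=> cf cg x; have fgx : {for x, continuous (fun y => (f y, g y))}.
  by apply: cvg_pair; [exact: cf|exact: cg].
have addx : {for (f x, g x), continuous (fun z : G * G => z.1 + z.2)}.
  exact: add_continuous.
exact: continuous_comp fgx addx.
Qed.

Lemma translation_continuous (a : G) : continuous (fun x : G => x + a).
Proof. by apply: continuous_add => x; [exact: cvg_id|exact: cvg_cst]. Qed.

Lemma mulrn_continuous n : continuous (fun x : G => x *+ n).
Proof.
elim: n => [|n IH].
  by under eq_fun do rewrite mulr0n; move=> x; exact: cvg_cst.
under eq_fun do rewrite mulrS.
by apply: continuous_add => // x; exact: cvg_id.
Qed.

Lemma nbhs_translate (x : G) (N : set G) : nbhs (0 : G) N -> nbhs x [set y | N (y - x)].
Proof. by move=> N0; apply: (@translation_continuous (- x) x); rewrite subrr. Qed.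

Lemma nbhs0_translate (x : G) (N : set G) : nbhs x N -> nbhs (0 : G) [set y | N (x + y)].
Proof.
move=> Nx; have := @translation_continuous x (0 : G).
rewrite /continuous_at add0r => /(_ _ Nx) h.
rewrite (_ : [set _ | _] = (fun y => y + x) @^-1` N) //.
by apply/seteqP; split=> y /=; rewrite addrC.
Qed.

Lemma open_of_nbhs0 (U : zmodClosed G) : nbhs (0 : G) (carrier U) -> open (carrier U).
Proof.
move=> U0; rewrite openE => x Ux; rewrite /interior.
apply: filterS (nbhs_translate x U0) => y /= Uyx.
by rewrite /carrier /= -[y](subrK x) rpredD.
Qed.

Lemma open_nbhs0 (U : zmodClosed G) : open (carrier U) -> nbhs (0 : G) (carrier U).
Proof. by move=> oU; apply: open_nbhs_nbhs; split=> //; apply: rpred0. Qed.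

Lemma open_carrier_closed (U : zmodClosed G) : open (carrier U) -> closed (carrier U).
Proof.
move=> oU x /(_ _ (nbhs_translate x (open_nbhs0 oU)))[y [Uy Uyx]].
by rewrite /carrier /= -[x](subKr y) rpredB.
Qed.

Lemma stabilizer_zmod_closed (K : set G) :
  zmod_closed [pred x : G | `[< forall k, K k -> K (k + x) /\ K (k - x) >]].
Proof.
split=> [|x y /asboolP Kx /asboolP Ky]; apply/asboolP => k Kk.
  by rewrite subr0 addr0.
have [/Ky[_ +] /Ky[+ _]] := Kx k Kk.
by rewrite opprB [y - x]addrC !addrA.
Qed.

Lemma pack_zmodClosed (P : {pred G}) : zmod_closed P ->
  exists U : zmodClosed G, (U : {pred G}) = P.
Proof.
move=> cP; pose U : zmodClosed G := HB.pack P (GRing.isZmodClosed.Build G P cP).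
by exists U.
Qed.

Hypotheses (cG : compact [set: G]) (hG : hausdorff_space G).

Lemma clopen_subgroup (K : set G) : clopen K -> K 0 ->
  exists U : zmodClosed G, open (carrier U) /\ carrier U `<=` K.
Proof.
(* The stabilizer of K under translation is open by the tube lemma. *)
move=> [oK clK] K0; have [U eU] := pack_zmodClosed (stabilizer_zmod_closed K).
have UE x : carrier U x <-> forall k, K k -> K (k + x) /\ K (k - x).
  by rewrite /carrier /= eU; split=> [/asboolP|?]; last exact/asboolP.
exists U; split; last by move=> x /UE/(_ _ K0)[]; rewrite add0r.
apply: open_of_nbhs0.
have cK : compact K by apply: subclosed_compact cG _.
have := (compact_near_coveringP K).1 cK _ (nbhs (0 : G)) (fun x k => K (k + x) /\ K (k - x)).
move=> /(_ (nbhs_filter _)) h; apply: filterS (h _) => [x Kx|k Kk].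
  by apply/UE => k; apply: Kx.
have nK : nbhs k K by apply: open_nbhs_nbhs.
apply: filterI.
- have := @add_continuous G (k, 0); rewrite /continuous_at /= addr0; exact.
- have := @sub_continuous G (k, 0); rewrite /continuous_at /= subr0; exact.
Qed.

Hypothesis tdG : totally_disconnected [set: G].

(** Clopen neighbourhoods of 0 are arbitrarily small by zero-dimensionality, and each contains an
    open subgroup, its stabilizer. *)
Lemma open_subgroup_basis (N : set G) : nbhs (0 : G) N ->
  exists U : zmodClosed G, open (carrier U) /\ carrier U `<=` N.
Proof.
move=> N0; have zG := totally_disconnected_zero_dimensional cG hG tdG.
have [K [K0 cK] KN] := zero_dimensional_cvg hG zG cG N0.
have [U [oU UK]] := clopen_subgroup cK K0.
by exists U; split=> //; apply: subset_trans UK KN.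
Qed.

Lemma closed_image (f : G -> G) (A : set G) : continuous f -> closed A -> closed (f @` A).
Proof.
move=> cf clA; apply: compact_closed => //; apply: continuous_compact.
  exact: continuous_subspaceT.
exact: subclosed_compact cG _.
Qed.

Lemma closed_sum (A B : set G) : closed A -> closed B ->
  closed [set x | exists a b, [/\ A a, B b & x = a + b]].
Proof.
move=> clA clB; rewrite (_ : [set _ | _] = (fun z : G * G => z.1 + z.2) @` (A `*` B)).
  apply: compact_closed => //; apply: continuous_compact.
    by apply: continuous_subspaceT; apply: add_continuous.
  by apply: compact_setX; apply: subclosed_compact cG _.
apply/seteqP; split=> [x [a [b [Aa Bb ->]]]|_ [[a b] [Aa Bb] <-]]; first by exists (a, b).
by exists a, b.
Qed.

(** The translates u_n + C_n are closed, nonempty and decreasing, so compactness gives a common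
    point. This serves both p-adic limits and infinite sums. *)
Lemma nested_limit (C : nat -> set G) (u : nat -> G) :
  (forall n, closed (C n)) -> (forall n, C n 0) ->
  (forall n x y, C n x -> C n y -> C n (x + y)) ->
  (forall n, C n.+1 `<=` C n) -> (forall n, C n (u n.+1 - u n)) ->
  exists l, forall n, C n (l - u n).
Proof.
move=> clC C0 CD Cdec Cu; pose K n := [set x | C n (x - u n)].
have Kdec m n : (m <= n)%N -> K n `<=` K m.
  move=> /subnKC <-; elim: (n - m)%N => [|k IH]; first by rewrite addn0.
  rewrite addnS; apply: subset_trans IH => x Kx.
  by rewrite /K /= -[x](subrK (u (m + k).+1)) -addrA; apply: CD => //; apply: Cdec.
apply: contrapT => nol.
have clK n : setT n -> closed (K n).
  move=> _; have cf := @translation_continuous (- u n).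
  exact: (preimage_closed (fun x _ => cf x) (clC n)).
have dirK i j : setT i -> setT j -> exists2 k, setT k & K k `<=` K i `&` K j.
  move=> _ _; exists (maxn i j) => // x Kx.
  by split; apply: Kdec Kx; rewrite (leq_maxl, leq_maxr).
have capK : \bigcap_(n in setT) K n `<=` set0.
  by move=> l Kl; apply: nol; exists l => n; apply: Kl.
have [|n _ /(_ (u n))] := compact_directed cG _ clK dirK open0 capK; first by exists 0%N.
by rewrite /K /= subrr; apply.
Qed.

End TopologicalGroup.

(** * Subgroups of finite index *)

Section FiniteQuotient.
Local Open Scope quotient_scope.
Local Open Scope classical_set_scope.
Variables (G : zmodType) (U : zmodClosed G) (n : nat).
Hypothesis Un : ([set: {ideal_quot U}] #= `I_n)%card.

Lemma ideal_quot_ordinals : exists f : 'I_n -> {ideal_quot U}, bijective f.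
Proof.
pose Q : zmodType := {ideal_quot U}.
have /card_set_bijP[f] : ([set: 'I_n] #= [set: Q])%card.
  exact: card_esym (card_eq_trans Un card_II).
by rewrite setTT_bijective => bf; exists f.
Qed.

Lemma mulrn_index (x : G) : x *+ n \in U.
Proof.
have [f [g fK gK]] := ideal_quot_ordinals.
pose q : {ideal_quot U} := \pi x.
(* Translation by q permutes the quotient, so it fixes the sum of all its elements. *)
have hi : injective (fun i => g (f i + q)).
  by move=> i j /(can_inj gK) /addIr /(can_inj fK).
have : \sum_i f i + q *+ n = \sum_i f i.
  rewrite [RHS](reindex_inj hi) /=; under [RHS]eq_bigr do rewrite gK.
  by rewrite big_split /= sumr_const card_ord.
rewrite -[RHS]addr0 => /addrI qn0.
rewrite -[x *+ n]subr0 Quotient.idealrBE raddfMn /= -/q qn0.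
by rewrite raddf0.
Qed.

Lemma index_code : exists c : G -> 'I_n, forall x y, c x = c y -> x - y \in U.
Proof.
have [f [g fK gK]] := ideal_quot_ordinals.
exists (fun x => g (\pi x)) => x y /(can_inj gK) e.
by rewrite Quotient.idealrBE e.
Qed.

End FiniteQuotient.

(** * The filtration of t(G) + pG by the subgroups W_n = G[n!] + pG *)

Section BoundedMod.
Variables (p : nat) (G : zmodType) (m : nat).

Definition bounded_mod : {pred G} :=
  [pred x : G | `[< exists a g : G, a *+ m = 0 /\ x = a + g *+ p >] ].

Lemma bounded_modP (x : G) :
  reflect (exists a g : G, a *+ m = 0 /\ x = a + g *+ p) (x \in bounded_mod).
Proof. exact: asboolP. Qed.

Lemma bounded_mod_zmod_closed : zmod_closed bounded_mod.
Proof.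
split=> [|_ _ /bounded_modP[t [g [tm ->]]] /bounded_modP[t' [g' [tm' ->]]]].
  by apply/bounded_modP; exists 0, 0; rewrite !mul0rn addr0.
apply/bounded_modP; exists (t - t'), (g - g'); split.
  by rewrite mulrnBl tm tm' subr0.
by rewrite opprD addrACA mulrnBl.
Qed.

HB.instance Definition _ :=
  GRing.isZmodClosed.Build G bounded_mod bounded_mod_zmod_closed.

Lemma bounded_mod_multiple (x : G) : x *+ p \in bounded_mod.
Proof. by apply/bounded_modP; exists 0, x; rewrite mul0rn add0r. Qed.

End BoundedMod.
Arguments bounded_mod p {G} m.

Section BoundedFiltration.
Variables (p : nat) (G : zmodType).

Lemma bounded_mod_fact_le m n (x : G) : (m <= n)%N ->
  x \in bounded_mod p m`! -> x \in bounded_mod p n`!.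
Proof.
move=> /subnKC <-; elim: (n - m)%N => [|k IH]; first by rewrite addn0.
move=> /IH /bounded_modP[a [g [am ->]]]; apply/bounded_modP; exists a, g; split=> //.
by rewrite addnS factS mulnC mulrnA am mul0rn.
Qed.

Lemma torsion_mod_bounded (x : G) :
  x \in torsion_mod p -> exists n, x \in bounded_mod p n`!.
Proof.
move=> /torsion_modP[t [g [/torsionP[n [n0 tn]] ->]]]; exists n.
apply/bounded_modP; exists t, g; split=> //.
by case: n n0 tn => // n _ tn; rewrite factS mulrnA tn mul0rn.
Qed.

Lemma bounded_torsion_mod n (x : G) : x \in bounded_mod p n`! -> x \in torsion_mod p.
Proof.
move=> /bounded_modP[a [g [am ->]]]; apply/torsion_modP; exists a, g; split=> //.
by apply/torsionP; exists n`!; rewrite fact_gt0.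
Qed.

End BoundedFiltration.

(* The branches of the binary tree, as pairwise almost disjoint subsets of nat. *)
Definition branch (beta : nat -> bool) (j : nat) : bool :=
  `[< exists n, j = pickle (mkseq beta n) >].

(** Distinct prefixes have distinct codes, so b + 1 prefixes cannot all have codes below b. *)
Lemma branch_unbounded (beta : nat -> bool) a b :
  exists n, (a <= n)%N /\ (b <= pickle (mkseq beta n))%N.
Proof.
apply: contrapT => no; have bnd (i : 'I_b.+1) : (pickle (mkseq beta (a + i)) < b)%N.
  by rewrite ltnNge; apply/negP => le; apply: no; exists (a + i)%N; rewrite leq_addr.
have inj : injective (fun i => Ordinal (bnd i)).
  move=> i j [] /(pcan_inj pickleK) /(congr1 size); rewrite !size_mkseq.
  by move/addnI/val_inj.
by have := leq_card _ inj; rewrite !card_ord ltnn.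
Qed.

Lemma branch_separation (beta : nat -> bool) (s : seq (nat -> bool)) :
  exists N, forall n gamma, (N <= n)%N -> gamma \in s ->
    branch gamma (pickle (mkseq beta n)) = (gamma == beta).
Proof.
have self n : branch beta (pickle (mkseq beta n)) by apply/asboolP; exists n.
elim: s => [|delta s [N HN]]; first by exists 0%N.
have [->|db] := eqVneq delta beta.
  exists N => n gamma Nn; rewrite inE => /orP[/eqP ->|]; last exact: HN.
  by rewrite self eqxx.
have [i di] : exists i, delta i <> beta i.
  by apply/existsNP => e; move/eqP: db; apply; apply/funext.
(* A prefix must have length at least i + 1 to show the entry i where [delta] and [beta] differ. *)
exists (maxn N i.+1) => n gamma; rewrite geq_max => /andP[Nn i_n].
rewrite inE => /orP[/eqP ->|]; last exact: HN.
rewrite (negPf db); apply/negP => /asboolP[m /(pcan_inj pickleK) e].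
have nm : n = m by have := congr1 size e; rewrite !size_mkseq.
subst m; apply: di; have := congr1 (fun t => nth false t i) e.
by rewrite !nth_mkseq.
Qed.

(** * Abelian pro-p groups *)

Section ProP.
Local Open Scope classical_set_scope.
Variables (p : nat) (G : topologicalZmodType).
Hypotheses (p_prime : prime p) (G_pro_p : pro_p G p).

Let cG : compact [set: G]. Proof. by case: G_pro_p => [[]]. Qed.
Let hG : hausdorff_space G. Proof. by case: G_pro_p => [[]]. Qed.
Let tdG : totally_disconnected [set: G]. Proof. by case: G_pro_p => [[]]. Qed.
Let p0 : (0 < p)%N. Proof. exact: prime_gt0. Qed.

Lemma closed_point (x : G) : closed [set x].
Proof. exact/accessible_closed_set1/hausdorff_accessible. Qed.

Lemma separating_subgroup (x : G) : x != 0 ->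
  exists U : zmodClosed G, open (carrier U) /\ x \notin U.
Proof.
move=> x0; have [|U [oU Ux]] := open_subgroup_basis cG hG tdG (N := ~` [set x]).
  apply: open_nbhs_nbhs; split; first exact/closed_openC/closed_point.
  by move=> /= e; rewrite e eqxx in x0.
by exists U; split=> //; apply/negP => /Ux; apply.
Qed.

Lemma multiple_closed m : closed [set x : G | multiple m x].
Proof.
rewrite (_ : [set _ | _] = (fun x : G => x *+ m) @` setT).
  by apply: closed_image => //; exact: mulrn_continuous.
by apply/seteqP; split=> [x [y ->]|_ [y _ <-]]; exists y.
Qed.

(** An open subgroup of index p^k contains p^k G, whence separatedness. The subgroups p^n G are
    closed as images of a compact group, whence limits exist. *)
Lemma pro_p_complete : p_complete p G.
Proof.
split=> [x px|u].
  apply: contrapT => /eqP /separating_subgroup[U [oU /negP]]; apply.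
  have [_ /(_ U oU)[k Uk]] := G_pro_p.
  by have [y ->] := px k; apply: mulrn_index.
apply: (nested_limit cG (C := fun n => [set x | multiple (p ^ n) x])) => n.
- exact: multiple_closed.
- exact: multiple0.
- exact: multipleD.
- by move=> x [y ->]; exists (y *+ p); rewrite -mulrnA expnS.
Qed.

Lemma bounded_mod_closed m : closed (carrier (bounded_mod p m : zmodClosed G)).
Proof.
rewrite (_ : carrier _ = [set x | exists a b : G,
  [/\ [set y : G | y *+ m = 0] a, [set z | multiple p z] b & x = a + b]]).
  apply: closed_sum => //; last exact: multiple_closed.
  exact: (preimage_closed (fun x _ => @mulrn_continuous G m x) (@closed_point 0)).
apply/seteqP; split=> x.
  by move=> /bounded_modP[a [g [am ->]]]; exists a, (g *+ p); split=> //; exists g.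
by move=> [a [_ [am [g ->] ->]]]; apply/bounded_modP; exists a, g.
Qed.

Hypothesis G_tors : unbounded_torsion G.

Lemma torsion_mod_not_bounded n :
  exists x : G, x \in torsion_mod p /\ x \notin bounded_mod p n`!.
Proof.
apply: contrapT => bnd; apply: G_tors; exists n`!; split; first exact: fact_gt0.
have {}bnd (x : G) : x \in torsion (G := G) -> x \in bounded_mod p n`!.
  move=> xT; apply: contrapT => /negP nx; apply: bnd; exists x; split=> //.
  exact: torsion_torsion_mod.
move=> x xT; apply: pro_p_complete.1 => k.
(* t(G) = G[n!] + p t(G) gives n! t(G) = p^k n! t(G) for all k. *)
elim: k x xT => [|k IH] x xT; first by exists (x *+ n`!); rewrite expn0 mulr1n.
have /bounded_modP[a [g [an ex]]] := bnd x xT.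
have [|y ey] := IH g; last first.
  by exists y; rewrite ex mulrnDl an add0r mulrnAC ey -mulrnA mulnC -expnS.
apply: (torsion_mulrn p0); have -> : g *+ p = x - a by rewrite ex addrC addKr.
by rewrite rpredB //; apply/torsionP; exists n`!; rewrite fact_gt0.
Qed.

Lemma bounded_mod_escape (U : zmodClosed G) n : open (carrier U) ->
  exists m v, [/\ (n < m)%N, v \in bounded_mod p m`!, v \in U & v \notin bounded_mod p n`!].
Proof.
move=> oU; apply: contrapT => noesc.
have {}noesc v : v \in torsion_mod p -> v \in U -> v \in bounded_mod p n`!.
  move=> /torsion_mod_bounded[m vm] vU; apply: contrapT => /negP nv; apply: noesc.
  exists (maxn m n.+1), v; split=> //; first by rewrite leq_maxr.
  by apply: bounded_mod_fact_le vm; rewrite leq_maxl.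
(* t(G) + pG is covered by finitely many cosets of U; pick a representative of each. *)
have [_ /(_ U oU)[k Uk]] := G_pro_p; have [c Hc] := index_code Uk.
have /choice[r Hr] : forall i, exists r : G * nat,
    (exists2 x, x \in torsion_mod p & c x = i) -> r.1 \in bounded_mod p r.2`! /\ c r.1 = i.
  move=> i; have [[x xT cx]|no] := pselect (exists2 x, x \in torsion_mod p & c x = i).
    by have [m xm] := torsion_mod_bounded xT; exists (x, m).
  by exists (0, 0%N) => /no.
(* W_N contains W_n and all chosen representatives. Each element of S differs from its
   representative by an element of S in U, hence of W_n, so S would lie in W_N. *)
pose N := maxn n (\max_i (r i).2).
have [x [xT /negP]] := torsion_mod_not_bounded N; apply.
have [rm cr] : (r (c x)).1 \in bounded_mod p (r (c x)).2`! /\ c (r (c x)).1 = c x.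
  by apply: Hr; exists x.
rewrite -[x](subrK (r (c x)).1) rpredD //; last first.
  apply: bounded_mod_fact_le rm.
  exact: leq_trans (leq_bigmax (F := fun i => (r i).2) (c x)) (leq_maxr _ _).
apply: bounded_mod_fact_le (leq_maxl _ _) _; apply: noesc.
  by rewrite rpredB //; apply: bounded_torsion_mod rm.
by apply: Hc; rewrite cr.
Qed.

(** Recursive choice: v_j lies in U_j but outside W_(n_j). As that subgroup is closed, U_(j+1) can
    be shrunk so that no tail from it brings v_j back. *)
Lemma escaping_sequence : exists (v : nat -> G) (n : nat -> nat) (U : nat -> zmodClosed G),
  forall j, [/\ open (carrier (U j)), (n j < n j.+1)%N,
    v j \in bounded_mod p (n j.+1)`! /\ v j \in U j,
    {subset U j.+1 <= U j} & forall u, u \in U j.+1 -> v j + u \notin bounded_mod p (n j)`!].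
Proof.
(* The state [s] holds the level n_j and the subgroup U_j; [r] holds v_j and the next state. *)
have step (s : nat * zmodClosed G) : exists r : G * (nat * zmodClosed G),
    open (carrier s.2) -> [/\ open (carrier r.2.2), (s.1 < r.2.1)%N,
    r.1 \in bounded_mod p (r.2.1)`! /\ r.1 \in s.2,
    {subset r.2.2 <= s.2} & forall u, u \in r.2.2 -> r.1 + u \notin bounded_mod p (s.1)`!].
  have [oU|no] := pselect (open (carrier s.2)); last by exists (0, s) => /no.
  have [m [v [nm vm vU nv]]] := bounded_mod_escape s.1 oU.
  have [|V [oV subV]] := open_subgroup_basis cG hG tdG
    (N := carrier s.2 `&` [set y | (~` carrier (bounded_mod p (s.1)`! : zmodClosed G)) (v + y)]).
    apply: filterI; first exact: open_nbhs0.
    apply: nbhs0_translate; apply: open_nbhs_nbhs; split; last exact/negP.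
    exact/closed_openC/bounded_mod_closed.
  exists (v, (m, V)) => _; split=> //= u /subV[] // _ /negP; exact.
have /choice[F HF] := step.
have [U0 [oU0 _]] := open_subgroup_basis cG hG tdG (N := setT) filterT.
pose S := fix S j := if j is i.+1 then (F (S i)).2 else (0%N, U0).
have oS j : open (carrier (S j).2).
  by elim: j => // j IH; have [] := HF _ IH.
exists (fun j => (F (S j)).1), (fun j => (S j).1), (fun j => (S j).2) => j.
by have [? ? [? ?] ? ?] := HF _ (oS j); split.
Qed.

Lemma independent_continuum : exists e : (nat -> bool) -> G, independent p e.
Proof.
have [v [n [U H]]] := escaping_sequence.
have U_open j : open (carrier (U j)) by case: (H j).
have vU j : v j \in U j by case: (H j) => _ _ [].
have Udec i j : (i <= j)%N -> {subset U j <= U i}.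
  move=> /subnKC <-; elim: (j - i)%N => [|k IH]; first by rewrite addn0.
  by move=> x; rewrite addnS; case: (H (i + k)%N) => _ _ _ sub _ /sub/IH.
have n_lt : {homo n : i j / (i < j)%N}.
  apply: (@homo_ltn _ _ (fun a b => (a < b)%N)) => [a b c|k]; first exact: ltn_trans.
  by case: (H k).
have n_ge j : (j <= n j)%N.
  by elim: j => // j /leq_ltn_trans; apply; apply: n_lt.
pose u (alpha : nat -> bool) m := \sum_(i < m) v i *+ alpha i.
(* [X alpha] is the infinite sum of the v_i with i in [alpha]; its tail from index m on lies in
   U_m. *)
have /choice[X HX] : forall alpha, exists l, forall m, l - u alpha m \in U m.
  move=> alpha; apply: (nested_limit cG (C := fun m => carrier (U m))).
  - by move=> m; apply: open_carrier_closed.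
  - by move=> m; apply: rpred0.
  - by move=> m x y; apply: rpredD.
  - by move=> m x; apply: Udec.
  - by move=> m; rewrite /u big_ord_recr /= [X in X - _]addrC addrK; apply: rpredMn.
exists (X \o branch) => s c us /torsion_mod_bounded[N HN] beta beta_s.
apply: contrapT => /negP pc; have [d [k dc]] := prime_invz p_prime pc.
have [N' sep] := branch_separation beta s.
(* At the index j, only the branch beta among those of s contributes. *)
have [l [N'l Nj]] := branch_unbounded beta N' N.
set j := pickle (mkseq beta l) in Nj.
have uW alpha : u alpha j \in bounded_mod p (n j)`!.
  apply: rpred_sum => i _; apply: rpredMn.
  have [_ _ [vW _] _ _] := H i; apply: bounded_mod_fact_le vW.
  have := ltn_ord i; move: (i : nat) => q.
  by rewrite leq_eqVlt => /orP[/eqP <-//|/n_lt/ltnW].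
pose T := \sum_(gamma <- s) (X (branch gamma) - u (branch gamma) j.+1) *~ c gamma.
pose A := \sum_(gamma <- s) u (branch gamma) j *~ c gamma.
(* Split the combination at j: the head A lies in W_(n_j), the tail T in U_(j+1), and in between
   only [beta] contributes. *)
have eT : lin (X \o branch) s c = A + v j *~ c beta + T.
  have -> : v j *~ c beta = \sum_(gamma <- s) (v j *+ branch gamma j) *~ c gamma.
    rewrite (bigD1_seq beta) //= big1_seq => [|gamma /andP[gb gs]].
      by rewrite addr0 (sep l) // eqxx.
    by rewrite (sep l) // (negPf gb) mul0rz.
  rewrite -!big_split; apply: eq_bigr => gamma _ /=.
  by rewrite -!mulrzDl /u big_ord_recr [Y in _ = Y *~ _]addrC subrK.
have TU : T \in U j.+1 by apply: rpred_sum => gamma _; apply: rpredMz.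
have AW : A \in bounded_mod p (n j)`! by apply: rpred_sum => gamma _; apply: rpredMz.
have [_ _ _ _ Hv] := H j.
(* Multiplying by [d] makes the coefficient of v_j equal to 1 modulo p, so the relation contradicts
   the choice of v_j. *)
suff : v j + T *~ d \in bounded_mod p (n j)`!.
  by apply/negP/Hv; apply: rpredMz.
have -> : v j + T *~ d = (lin (X \o branch) s c - A) *~ d - v j *~ k *+ p.
  rewrite eT -[A + _ + T]addrA [Y in Y - A]addrC addrK mulrzDl.
  rewrite -mulrzA [c beta * d]mulrC dc mulrzDr mulr1z.
  by rewrite pmulrn -mulrzA [Y in Y - _]addrAC addrK.
rewrite rpredB ?bounded_mod_multiple // rpredMz // rpredB //.
(* Since N <= j <= n_j, the combination, known to be in W_N, is in W_(n_j). *)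
exact: bounded_mod_fact_le (leq_trans Nj (n_ge j)) HN.
Qed.

Lemma countably_based_injection : countably_based G ->
  exists f : G -> nat -> bool, injective f.
Proof.
move=> [B [/countable_injP[idx idx_inj] Bn Bcvg]].
have /choice[code Hcode] : forall A : set G, exists c : G -> nat,
    B A -> forall x y, c x = c y -> A (x - y).
  move=> A; have [BA|no] := pselect (B A); last by exists (fun=> 0%N) => /no.
  have [U [oU UA]] := open_subgroup_basis cG hG tdG (Bn _ BA).
  have [_ /(_ U oU)[k Uk]] := G_pro_p; have [c Hc] := index_code Uk.
  by exists (fun x => c x) => _ x y /val_inj/Hc/UA.
(* An element is encoded by its coset labels modulo open subgroups inside the basic neighbourhoods,
   as a subset of nat. Some basic neighbourhood excludes x - y when x and y differ. *)
exists (fun x k => `[< exists2 A, B A & k = pickle (idx A, code A x) >]) => x y e.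
apply/eqP; rewrite -subr_eq0; apply: contrapT => xy.
have [A BA sub] : filter_from B id (~` [set x - y]).
  apply: Bcvg; apply: open_nbhs_nbhs; split; first exact/closed_openC/closed_point.
  by move=> /= e'; apply: xy; rewrite -e'.
have /asboolP[A' BA' /(pcan_inj pickleK)[eA ec]] :
    `[< exists2 A', B A' & pickle (idx A, code A x) = pickle (idx A', code A' y) >].
  have := congr1 (fun h => h (pickle (idx A, code A x))) e.
  by move=> <-; apply/asboolP; exists A.
have AA : A = A' by apply: idx_inj; rewrite ?inE.
by rewrite -AA in ec; apply: (sub (x - y)) => //; apply: Hcode ec.
Qed.

(** The index type is the same for all such groups, which lets bases of G and H be matched. *)
Lemma pro_p_basis : countably_based G ->
  exists x : (nat -> bool) -> G, independent p x /\ spanning p x.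
Proof.
move=> /countably_based_injection[f fi]; have [e ie] := independent_continuum.
exact: (@exists_basis p G p_prime ((nat -> bool) : choiceType) (fun=> false) e f fi ie).
Qed.

End ProP.

(** * The equivalence *)

Lemma torsion_isom (G H : zmodType) :
  group_isom G H -> group_isom (torsion_subgroup G) (torsion_subgroup H).
Proof.
(* Homomorphisms preserve torsion, so an isomorphism and its inverse both restrict. *)
have img (A B : zmodType) (f : {additive A -> B}) (t : torsion_subgroup A) :
    f (torsion_val t) \in torsion (G := B).
  have /torsionP[n [n0 tn]] := torsion_valP t; apply/torsionP; exists n; split=> //.
  by rewrite -raddfMn tn raddf0.
move=> [f [g fK gK]].
have gB : zmod_morphism g by move=> x y; apply: (can_inj fK); rewrite raddfB !gK.
pose g' : {additive H -> G} := HB.pack g (GRing.isZmodMorphism.Build _ _ g gB).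
pose F t := TorsionSubgroup (img G H f t).
have FB : zmod_morphism F.
  by move=> x y; apply: val_inj => /=; rewrite -[torsion_val _]/(val _) !raddfB.
pose F' : {additive torsion_subgroup G -> torsion_subgroup H} :=
  HB.pack F (GRing.isZmodMorphism.Build _ _ F FB).
exists F'; exists (fun t => TorsionSubgroup (img H G g' t)) => t; apply: val_inj => /=.
  exact: fK.
exact: gK.
Qed.

Theorem corollary3p2 (p : nat) (G H : topologicalZmodType)
    (p_prime : prime p)
    (G_pro_p : pro_p G p) (H_pro_p : pro_p H p)
    (G_cb : countably_based G) (H_cb : countably_based H)
    (G_tors : unbounded_torsion G) (H_tors : unbounded_torsion H) :
  group_isom G H <-> group_isom (torsion_subgroup G) (torsion_subgroup H).
Proof.
split; first exact: torsion_isom.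
have [x [ix sx]] := pro_p_basis p_prime G_pro_p G_tors G_cb.
have [y [iy sy]] := pro_p_basis p_prime H_pro_p H_tors H_cb.
have cG := pro_p_complete G_pro_p.
have cH := pro_p_complete H_pro_p.
exact: basis_isom (prime_gt0 p_prime) cG cH ix sx iy sy.
Qed.
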